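(* Let $D=(V,A)$ be a digraph on $n$ nodes and let $\mu_1,\dots,\mu_k$ be positive integers with $\mu_j\le n-1$. Then $D$ has $k$ (arc-)disjoint branchings $B_1,\dots,B_k$ with $|B_j|=\mu_j$ $(j=1,\dots,k)$ if and only if $$\sum_{i=1}^q\varrho_D(V_i)\ge\sum_{j=1}^k[q-(n-\mu_j)]^+$$ for every subpartition $\{V_1,\dots,V_q\}$ of $V$.
   Context: A branching is a spanning subgraph (identified with its arc set $B$) that is a directed forest in which every node has in-degree at most one (equivalently, a union of node-disjoint arborescences covering $V$); its size is $|B|$. $\varrho_D(X)$ is the number of arcs of $D$ with tail outside $X$ and head in $X$. $x^+=\max\{x,0\}$. A subpartition of $V$ is a family of pairwise disjoint nonempty subsets of $V$. *)

(* Defs.v *)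
From mathcomp Require Import all_boot.

Set Implicit Arguments.
Unset Strict Implicit.
Unset Printing Implicit Defensive.

(* MathComp world. Parallel arcs and loops are allowed. *)
Record digraph (V A : finType) := Digraph { tail : A -> V; head : A -> V }.

Section Branchings.
Variables (V A : finType) (D : digraph V A).
Implicit Types (B : {set A}) (X : {set V}) (P : {set {set V}}).

Definition rho X : nat := #|[set a | (tail D a \notin X) && (head D a \in X)]|.

Definition joins (a : A) (u v : V) : bool :=
  ((tail D a == u) && (head D a == v)) || ((tail D a == v) && (head D a == u)).

(* [:: (v_1, a_1); ...; (v_m, a_m)], m >= 1, encodes the cycle v_1 a_1 v_2 a_2
   ... v_m a_m v_1 of the underlying undirected multigraph; a loop is a cycle
   with m = 1 and two parallel or opposite arcs form a cycle with m = 2. *)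
Definition undirected_cycle B (s : seq (V * A)) : bool :=
  [&& s != [::], uniq (map fst s), uniq (map snd s),
      all (fun p => p.2 \in B) s &
      cycle (fun p q => joins p.2 p.1 q.1) s].

Definition is_forest B : Prop := forall s, ~~ undirected_cycle B s.

Definition in_degree B (v : V) : nat := #|[set a in B | head D a == v]|.

Definition is_branching B : Prop :=
  is_forest B /\ forall v, in_degree B v <= 1.

Definition subpartition P : bool := trivIset P && (set0 \notin P).

End Branchings.

(* Main.v *)
Require Import Defs.
From mathcomp Require Import all_boot zify.

(* Necessity: in a branching with root set R, every member of a subpartition
   that avoids R is entered by an arc, for otherwise following arcs backwards
   inside it closes a cycle.

   Sufficiency: by Edmonds' theorem (proved here by Lovasz's method) it is
   enough to find root sets R_j with #|R_j| = n - mu_j such that each nonempty X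
   is met by at least k - rho(X) of them.  These are chosen one at a time, and
   each R_j element by element: the intersecting submodular function
   t(X) = rho(X) + #{chosen root sets meeting X} must keep satisfying
   k |P| <= \sum_(X in P) t(X) + (a concave function of |P|), and replacing the
   concave function by the linear functions above it turns this into finitely
   many constraints c_i |P| <= \sum_(X in P) t(X) + M_i.  Uncrossing shows that
   the tight subpartitions of all these constraints have a common element
   outside the part of R_j chosen so far, which can be added to it. *)

Set Implicit Arguments.
Unset Strict Implicit.
Unset Printing Implicit Defensive.

(** * Root sets *)

Section Uncrossing.
Variable V : finType.
Implicit Types (X Y Z R : {set V}) (P Q S : {set {set V}}).

(** * Meeting sets, subpartitions and intersecting submodularity *)

Definition meets X Y := ~~ [disjoint X & Y].

Lemma meetsP X Y : reflect (exists2 x, x \in X & x \in Y) (meets X Y).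
Proof.
rewrite /meets -setI_eq0; apply: (iffP (set0Pn _)).
  by case=> x /setIP[]; exists x.
by case=> x xX xY; exists x; apply/setIP.
Qed.

Lemma meetsC X Y : meets X Y = meets Y X.
Proof. by rewrite /meets disjoint_sym. Qed.

Lemma meetsU X Y Z : meets (X :|: Y) Z = meets X Z || meets Y Z.
Proof. by rewrite /meets -!setI_eq0 setIUl setU_eq0 negb_and. Qed.

Lemma meetsIS X Y Z : Y \subset Z -> meets X Y -> meets X Z.
Proof. by move=> /subsetP sYZ /meetsP[x xX /sYZ xZ]; apply/meetsP; exists x. Qed.

Lemma meetsSI X Y Z : X \subset Y -> meets X Z -> meets Y Z.
Proof. by rewrite !(meetsC _ Z); apply: meetsIS. Qed.

Lemma subpartitionP P :
  reflect ((forall X Y x, X \in P -> Y \in P -> x \in X -> x \in Y -> X = Y)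
           /\ (forall X, X \in P -> X != set0))
          (subpartition P).
Proof.
apply: (iffP andP) => [[/trivIsetP tP P0]|[tP P0]]; split.
- move=> X Y x XP YP xX xY; apply/eqP/idPn => /(tP _ _ XP YP).
  by apply/negP/meetsP; exists x.
- by move=> X XP; apply: contraNneq P0 => <-.
- apply/trivIsetP => X Y XP YP; apply: contraNT => /meetsP[x xX xY].
  exact/eqP/(tP _ _ x).
- by apply/negP => /P0; rewrite eqxx.
Qed.

Lemma subpartition1 X : X != set0 -> subpartition [set X].
Proof.
move=> X0; apply/subpartitionP; split=> [A B x /set1P-> /set1P->|A /set1P->] //.
Qed.

Definition intersecting_submodular (t : {set V} -> nat) :=
  forall X Y, meets X Y -> t (X :&: Y) + t (X :|: Y) <= t X + t Y.

(** The indicator of meeting [R] is itself submodular, so root sets already chosen can be counted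
    into [t]. *)
Lemma intersecting_submodular_meets t R :
  intersecting_submodular t -> intersecting_submodular (fun X => t X + meets X R).
Proof.
move=> sub X Y meet; rewrite addnACA [leqRHS]addnACA leq_add ?sub // meetsU.
have := @meetsSI _ _ R (subsetIl X Y); have := @meetsSI _ _ R (subsetIr X Y).
by do 3!case: (meets _ _) => //; move=> // /(_ isT) // _ /(_ isT).
Qed.

(** * Uncrossing two subpartitions at one member *)

Definition meeting P Y := [set X in P | meets X Y].
(* Uncrossing P and Q at a single member Y of Q: Y is merged in P with all the
   members it meets, and replaced in Q by its traces on them. *)
Definition absorb P Y := (Y :|: cover (meeting P Y)) |: (P :\: meeting P Y).
Definition shatter Q Y P := [set X :&: Y | X in meeting P Y] :|: (Q :\ Y).

Lemma in_not_meeting P Y X :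
  (X \in P :\: meeting P Y) = (X \in P) && ~~ meets X Y.
Proof. by rewrite !inE; case: (X \in P); case: meets. Qed.

Lemma subpartition_absorb P Y :
  subpartition P -> Y != set0 -> subpartition (absorb P Y).
Proof.
move=> /subpartitionP[tP P0] Y0; apply/subpartitionP; split; last first.
  move=> X /setU1P[->|/setDP[/P0//]].
  by rewrite setU_eq0 negb_and Y0.
have new X x : X \in P :\: meeting P Y -> x \in X ->
    x \notin Y :|: cover (meeting P Y).
  rewrite in_not_meeting => /andP[XP nXY] xX; apply/negP => /setUP[xY|].
    by case/negP: nXY; apply/meetsP; exists x.
  case/bigcupP => Z /setIdP[ZP ZY] xZ.
  by rewrite (tP _ _ x XP ZP) ?ZY in nXY.
move=> X Z x /setU1P[->|XP] /setU1P[->|ZP] // xX xZ.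
- by have := new _ _ ZP xZ; rewrite xX.
- by have := new _ _ XP xX; rewrite xZ.
by move: XP ZP => /setDP[XP _] /setDP[ZP _]; apply: (tP _ _ x).
Qed.

Lemma subpartition_shatter P Q Y :
  subpartition P -> subpartition Q -> Y \in Q -> subpartition (shatter Q Y P).
Proof.
move=> /subpartitionP[tP _] /subpartitionP[tQ Q0] YQ; apply/subpartitionP; split.
  move=> X Z x /setUP[/imsetP[X' /setIdP[XP _] ->]|/setD1P[nXY XQ]]
              /setUP[/imsetP[Z' /setIdP[ZP _] ->]|/setD1P[nZY ZQ]].
  - by move=> /setIP[xX _] /setIP[xZ _]; rewrite (tP _ _ x XP ZP).
  - by move=> /setIP[_ xY] xZ; rewrite (tQ _ _ x YQ ZQ) ?eqxx in nZY.
  - by move=> xX /setIP[_ xY]; rewrite (tQ _ _ x YQ XQ) ?eqxx in nXY.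
  - exact: tQ.
move=> X /setUP[/imsetP[X' /setIdP[_]]|/setD1P[_ /Q0//]].
by rewrite /meets -setI_eq0 => h ->.
Qed.

Section Sums.
Variables (P Q : {set {set V}}) (Y : {set V}).
Hypotheses (sP : subpartition P) (sQ : subpartition Q) (YQ : Y \in Q).

Lemma absorb_fresh : Y :|: cover (meeting P Y) \notin P :\: meeting P Y.
Proof.
rewrite in_not_meeting negb_and negbK meetsU; apply/orP; right; apply/orP; left.
have /subpartitionP[_ /(_ _ YQ) /set0Pn[x xY]] := sQ.
by apply/meetsP; exists x.
Qed.

Lemma shatter_fresh :
  [disjoint [set X :&: Y | X in meeting P Y] & Q :\ Y].
Proof.
apply/pred0P => Z /=; apply/negP => /andP[/imsetP[X /setIdP[_ /meetsP[x xX xY]] ->]].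
case/setD1P=> /eqP nY ZQ; case/subpartitionP: sQ => /(_ _ _ x ZQ YQ) + _.
by move=> /(_ _ _)/nY; apply=> //; apply/setIP.
Qed.

Lemma shatter_inj : {in meeting P Y &, injective (fun X => X :&: Y)}.
Proof.
move=> X Z /setIdP[XP /meetsP[x xX xY]] /setIdP[ZP _] /setP/(_ x).
rewrite !inE xX xY !andbT => /esym xZ.
by case/subpartitionP: sP => /(_ _ _ x XP ZP xX xZ).
Qed.

Lemma big_absorb (t : {set V} -> nat) :
  \sum_(X in absorb P Y) t X =
  t (Y :|: cover (meeting P Y)) + \sum_(X in P :\: meeting P Y) t X.
Proof. by rewrite /absorb big_setU1 ?absorb_fresh. Qed.

Lemma big_shatter (t : {set V} -> nat) :
  \sum_(X in shatter Q Y P) t X =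
  \sum_(X in meeting P Y) t (X :&: Y) + \sum_(X in Q :\ Y) t X.
Proof.
rewrite /shatter -(big_imset _ shatter_inj) /= -bigU ?shatter_fresh //.
by apply: eq_bigl => X; rewrite inE.
Qed.

Lemma big_not_meeting (t : {set V} -> nat) :
  \sum_(X in P) t X =
  \sum_(X in meeting P Y) t X + \sum_(X in P :\: meeting P Y) t X.
Proof.
rewrite (big_setID (meeting P Y)) /=; congr (_ + _).
by apply: eq_bigl => X; rewrite !inE andbA andbb.
Qed.

Lemma uncross_card :
  #|absorb P Y| + #|meeting P Y| = #|P|.+1 /\
  #|shatter Q Y P| + 1 = #|Q| + #|meeting P Y|.
Proof.
rewrite -!sum1_card big_absorb big_shatter big_not_meeting.
by rewrite (big_setD1 Y YQ) /= !sum1_card; split; lia.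
Qed.

(** The members of [S] are merged into [Y] one at a time. Since they are disjoint, each [X]
    intersects the set gathered so far in [X :&: Y] only, and submodularity applies to these two
    sets. *)
Lemma submodular_cover (t : {set V} -> nat) S :
  intersecting_submodular t -> S \subset meeting P Y ->
  t (Y :|: cover S) + \sum_(X in S) t (X :&: Y) <= t Y + \sum_(X in S) t X.
Proof.
move=> sub; have [n] := ubnP #|S|; elim: n S => // n IHn S ltSn sS.
have [->|/set0Pn[X XS]] := eqVneq S set0.
  by rewrite !big_set0 /cover big_set0 setU0.
have {}ltSn : #|S :\ X| < n by rewrite (cardsD1 X) XS in ltSn.
have /IHn/(_ _) := ltSn; rewrite (subset_trans (subD1set S X)) // => /(_ isT) IH.
rewrite 2!(big_setD1 X XS) /=.
have -> : Y :|: cover S = X :|: (Y :|: cover (S :\ X)).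
  by rewrite /cover (big_setD1 X XS) /= setUCA.
have : X \in meeting P Y by apply: (subsetP sS).
case/setIdP => XP mXY.
have XI : X :&: (Y :|: cover (S :\ X)) = X :&: Y.
  apply/setP=> x; rewrite !inE; have [xX|//] := boolP (x \in X).
  rewrite /= orb_idr // => /bigcupP[Z /setD1P[/eqP nZX /(subsetP sS)/setIdP[ZP _]] xZ].
  by case: nZX; case/subpartitionP: sP => /(_ _ _ x ZP XP xZ xX).
have mX : meets X (Y :|: cover (S :\ X)) by apply: meetsIS mXY; apply: subsetUl.
move: (sub _ _ mX) IH; rewrite XI.
by move: (\sum_(Z in S :\ X) t (Z :&: Y)) (\sum_(Z in S :\ X) t Z); lia.
Qed.

Lemma uncross_sum (t : {set V} -> nat) : intersecting_submodular t ->
  \sum_(X in absorb P Y) t X + \sum_(X in shatter Q Y P) t X <=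
  \sum_(X in P) t X + \sum_(X in Q) t X.
Proof.
move=> /(@submodular_cover t (meeting P Y)) /(_ (subxx _)).
rewrite big_absorb big_shatter big_not_meeting (big_setD1 Y YQ) /=.
by move: (\sum_(Z in Q :\ Y) t Z); lia.
Qed.

End Sums.

(** * Tight subpartitions and a free node common to all of them *)

Section Augment.
Variables (t : {set V} -> nat) (I : finType) (c M : I -> nat) (R : {set V}) (r : nat).
Hypothesis sub : intersecting_submodular t.

Definition unhit P := [set X in P | ~~ meets X R].

(* R is the chosen part of a root set that still lacks r elements, and t already
   counts R. *)
Hypothesis r_gt0 : 0 < r.
Hypothesis bound : forall i P, subpartition P ->
  c i * #|P| <= \sum_(X in P) t X + M i + r.
Hypothesis bound_unhit : forall i P, subpartition P ->
  c i * #|P| <= \sum_(X in P) t X + M i + #|unhit P|.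

Definition tight i P :=
  subpartition P && (c i * #|P| == \sum_(X in P) t X + M i + r).

(* Tight subpartitions of constraints with the same slope c can be uncrossed
   freely; with different slopes, the change in the cardinals is constrained. *)
Lemma tight_uncross i j P Q Y : tight i P -> tight j Q -> Y \in Q ->
  let x := #|meeting P Y| in
  c i + c j * x <= c i * x + c j /\
  (c i + c j * x = c i * x + c j ->
   tight i (absorb P Y) /\ tight j (shatter Q Y P)).
Proof.
move=> /andP[sP /eqP eP] /andP[sQ /eqP eQ] YQ x.
have Y0 : Y != set0 by case/subpartitionP: sQ => _; apply.
have sP' := subpartition_absorb sP Y0.
have sQ' := subpartition_shatter sP sQ YQ.
have [kP kQ] := uncross_card sP sQ YQ.
have le := uncross_sum sP sQ YQ sub.
have bP := bound i sP'; have bQ := bound j sQ'.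
rewrite /tight sP' sQ' /=.
have kP' : c i * #|absorb P Y| + c i * x = c i * #|P| + c i.
  by rewrite -mulnDr kP mulnS addnC.
have kQ' : c j * #|shatter Q Y P| + c j = c j * #|Q| + c j * x.
  by rewrite -mulnDr -kQ mulnDr muln1.
move: le bP bQ eP eQ kP' kQ'; rewrite /x.
move: (\sum_(X in absorb P Y) t X) (\sum_(X in shatter Q Y P) t X) => a b.
move: (\sum_(X in P) t X) (\sum_(X in Q) t X) => a' b'.
move: (c i * _) (c i * _) (c i * _) (c j * _) (c j * _) (c j * _) => *.
by split=> [|eqx]; [lia|split; apply/eqP; lia].
Qed.

Definition free P := cover (unhit P).

Lemma in_free P v : reflect (exists X, [/\ X \in P, ~~ meets X R & v \in X]) (v \in free P).
Proof.
apply: (iffP bigcupP) => [[X /setIdP[XP nX] vX]|[X [XP nX vX]]]; exists X => //.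
by apply/setIdP.
Qed.

Definition minimal_tight i P :=
  tight i P /\ forall Q, tight i Q -> free Q \subset free P -> free P \subset free Q.

Lemma minimal_tight_exists i P : tight i P -> exists Q, minimal_tight i Q.
Proof.
move=> tP; case: (arg_minnP (fun Q => #|free Q|) tP) => Q tQ minQ.
exists Q; split=> // S tS sSQ.
by have /eqP<- : free S == free Q by rewrite eqEcard sSQ minQ.
Qed.

(** Equality in [tight] compared with [bound_unhit] gives [r <= #|unhit P|]. *)
Lemma unhit_neq0 i P : tight i P -> exists X, X \in unhit P.
Proof.
move=> /andP[sP /eqP eP]; have := bound_unhit i sP.
by rewrite eP leq_add2l => /(leq_trans r_gt0); rewrite card_gt0 => /set0Pn.
Qed.

(** The merged member contains [Y], hence meets [R], so the nodes of [X :&: Y] stop being free. For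
    a minimal [P] such an absorption therefore cannot be tight. *)
Lemma free_absorb P Y X : subpartition P -> X \in unhit P -> meets X Y -> meets Y R ->
  free (absorb P Y) \subset free P /\ ~~ (free P \subset free (absorb P Y)).
Proof.
move=> /subpartitionP[tP _] /setIdP[XP nXR] mXY mYR; split.
  apply/subsetP=> v /in_free[Z [/setU1P[->|/setDP[ZP _]]]].
    by rewrite meetsU mYR.
  by move=> nZ vZ; apply/in_free; exists Z.
have /meetsP[x xX xY] := mXY.
apply/negP => /subsetP/(_ x) => /(_ _)/in_free[|Z []].
  by apply/in_free; exists X.
move=> /setU1P[->|]; first by rewrite meetsU mYR.
rewrite in_not_meeting => /andP[ZP] /negP nZ _ xZ; case: nZ.
by rewrite -(tP _ _ x XP ZP).
Qed.

Lemma free_shatter P X Q : ~~ meets X R -> X \in P ->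
  free (shatter P X Q) \subset free P.
Proof.
move=> nXR XP; apply/subsetP => v /in_free[Z [+ nZR vZ]].
case/setUP=> [/imsetP[Y /setIdP[YQ _] eZ]|/setD1P[_ ZP]]; apply/in_free.
  by exists X; split=> //; move: vZ; rewrite eZ => /setIP[].
by exists Z.
Qed.

Lemma in_free_shatter P X Q v : subpartition P -> X \in P -> v \in X ->
  v \in free (shatter P X Q) -> exists2 Y, Y \in meeting Q X & v \in Y.
Proof.
move=> /subpartitionP[tP _] XP vX /in_free[Z [+ _ vZ]].
case/setUP=> [/imsetP[Y YQ eZ]|/setD1P[/eqP nZ ZP]].
  by exists Y => //; move: vZ; rewrite eZ => /setIP[].
by case: nZ; apply: (tP _ _ v).
Qed.

(** Let [v] be a node of an unhit [X] in [P]. Shattering [X] by [Q] stays tight, so by minimality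
    [v] remains free and lies in some [Y] of [Q]. If [Y] met [R], absorbing it would shrink
    [free P]. *)
Lemma minimal_same i j P Q : minimal_tight i P -> tight j Q -> c i = c j ->
  free P \subset free Q.
Proof.
move=> [tP minP] tQ cij; have /andP[sP _] := tP.
apply/subsetP => v /in_free[X [XP nXR vX]].
have [_ /(_ _)[|_ tS]] := tight_uncross tQ tP XP; first by rewrite cij addnC.
have /subsetP/(_ v) := minP _ tS (free_shatter Q nXR XP).
move=> /(_ _)/(in_free_shatter sP XP vX)[|Y /setIdP[YQ mYX] vY].
  by apply/in_free; exists X.
apply/in_free; exists Y; split=> //; apply/negP => mYR.
have [_ /(_ _)[|tA _]] := tight_uncross tP tQ YQ; first by rewrite cij addnC.
have [||le /negP[]] := @free_absorb P Y X sP _ _ mYR; rewrite 1?meetsC //.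
  exact/setIdP.
exact: minP.
Qed.

Lemma minimal_finer i j P Q X : minimal_tight i P -> minimal_tight j Q ->
  c i < c j -> X \in unhit P -> exists2 Y, Y \in unhit Q & Y \subset X.
Proof.
move=> [tP minP] [tQ minQ] cij XU; have /setIdP[XP nXR] := XU.
have /andP[sP _] := tP; have /andP[sQ _] := tQ.
(* If no member of [Q] met [X], uncrossing at [X] would give [c j <= c i]. *)
have [Y] : exists Y, Y \in meeting Q X.
  apply/set0Pn; rewrite -card_gt0.
  by have [] := tight_uncross tQ tP XP; case: #|_| => //; lia.
case/setIdP=> YQ mYX; have mXY : meets X Y by rewrite meetsC.
have XM : X \in meeting P Y by apply/setIdP.
have [le] := tight_uncross tP tQ YQ.
(* Uncrossing at [Y] the other way round allows at most one member, as [c i < c j]; with exactly one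
   the slopes balance and both results are tight. *)
have x1 : #|meeting P Y| = 1.
  have : 0 < #|meeting P Y| by rewrite card_gt0; apply/set0Pn; exists X.
  move: le; case: #|_| => [|[|m]] //; nia.
rewrite x1 => /(_ _)[|tA tS]; first by rewrite !muln1.
have nYR : ~~ meets Y R.
  apply/negP => mYR.
  by have [le' /negP[]] := free_absorb sP XU mXY mYR; apply: minP.
exists Y; first by apply/setIdP.
apply/subsetP => v vY.
have /subsetP/(_ v) := minQ _ tS (free_shatter P nYR YQ).
move=> /(_ _)/(in_free_shatter sQ YQ vY)[|X' X'M vX'].
  by apply/in_free; exists Y.
by have /eqP/cards1P[Z eZ] := x1; move: X'M XM; rewrite eZ => /set1P<- /set1P->.
Qed.

(* Minimal tight subpartitions get finer as the slope c grows, so going through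
   the slopes in increasing order produces shrinking members X. *)
Lemma common_unhit n : (exists i P, c i <= n /\ tight i P) ->
  exists i P X, [/\ c i <= n, minimal_tight i P, X \in unhit P &
   forall j Q, c j <= n -> tight j Q -> c j <= c i /\ X \subset free Q].
Proof.
have same a b P Q X : minimal_tight a P -> tight b Q -> X \in unhit P ->
    c a = c b -> X \subset free Q.
  by move=> mP tQ XP /(minimal_same mP tQ); apply: subset_trans; apply: bigcup_sup.
elim: n => [|n IHn] [i [P [ci tP]]].
  have [Q mQ] := minimal_tight_exists tP; have [X XQ] := unhit_neq0 (proj1 mQ).
  exists i, Q, X; split=> // j S cj tS; split; first lia.
  by apply: (same _ _ _ _ _ mQ tS XQ); lia.
have [/existsP[j /existsP[S /andP[/eqP cj tS]]]|none] :=
    boolP [exists j, exists S, (c j == n.+1) && tight j S]; last first.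
  have lt j S : c j <= n.+1 -> tight j S -> c j <= n.
    rewrite leq_eqVlt => /predU1P[cj tS|//]; case/negP: none.
    by apply/existsP; exists j; apply/existsP; exists S; rewrite cj eqxx.
  have [|j [Q [X [cj mQ XQ XS]]]] := IHn; first by exists i, P; split=> //; apply: lt tP.
  by exists j, Q, X; split=> //; [lia | move=> l S cl tS; apply: XS (lt _ _ cl tS) tS].
have [Q mQ] := minimal_tight_exists tS.
have [/existsP[l /existsP[T /andP[cl tT]]]|none] :=
    boolP [exists l, exists T, (c l <= n) && tight l T].
  have [|l' [T' [X [cl' mT' XT' XS]]]] := IHn; first by exists l, T.
  (* [X] is free in every tight subpartition of slope at most [n]; the finer [Y] inside it also
     serves slope [n.+1]. *)
  have [|Y YQ YX] := minimal_finer mT' mQ _ XT'; first by lia.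
  exists j, Q, Y; rewrite cj; split=> // a Z; rewrite leq_eqVlt => /predU1P[ca tZ|ca tZ].
    by split; [lia | apply: (same _ _ _ _ _ mQ tZ YQ); lia].
  by split; [lia | have [_] := XS _ _ ca tZ; apply: subset_trans].
have [X XQ] := unhit_neq0 (proj1 mQ).
exists j, Q, X; rewrite cj; split=> // a Z; rewrite leq_eqVlt => /predU1P[ca tZ|ca tZ].
  by split; [lia | apply: (same _ _ _ _ _ mQ tZ XQ); lia].
by case/negP: none; apply/existsP; exists a; apply/existsP; exists Z; rewrite tZ -ltnS ca.
Qed.

Lemma common_free : (exists i P, tight i P) ->
  exists v, forall i P, tight i P -> v \in free P.
Proof.
move=> [i [P tP]]; set n := \max_j c j.
have cn j : c j <= n by apply: leq_bigmax.
have [|j [Q [X [_ [/andP[sQ _] _] /setIdP[XQ _] XS]]]] := @common_unhit n.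
  by exists i, P.
case/subpartitionP: sQ => _ /(_ _ XQ) /set0Pn[v vX]; exists v => l S tS.
by have [_ /subsetP] := XS l S (cn l) tS; apply.
Qed.

End Augment.

(** * Choosing root sets, one element at a time *)

Lemma unhit_card P R : \sum_(X in P) meets X R + #|unhit R P| = #|P|.
Proof.
rewrite -!sum1_card [\sum_(X in unhit R P) 1](eq_bigl (fun X => (X \in P) && ~~ meets X R));
  last by move=> X; rewrite inE.
by rewrite big_mkcondr -big_split; apply: eq_bigr => X _; case: meets.
Qed.

Lemma meetsU1 X R v : meets X (v |: R) = (v \in X) || meets X R.
Proof.
by rewrite meetsC meetsU (meetsC R); congr (_ || _); rewrite /meets disjoints1 negbK.
Qed.

Lemma sum_meetsU1 P R v : v \in free R P ->
  \sum_(X in P) meets X R < \sum_(X in P) meets X (v |: R).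
Proof.
move=> /in_free[X [XP nX vX]]; rewrite !(bigD1 X XP) /= meetsU1 vX (negPf nX).
rewrite ltnS leq_sum // => Y _; rewrite meetsU1.
by case: (v \in Y); case: meets.
Qed.

Lemma exists_hitting_set (s : {set V} -> nat) (I : finType) (c M : I -> nat) m :
  intersecting_submodular s -> m <= #|V| ->
  (forall i P, subpartition P ->
     c i * #|P| <= \sum_(X in P) s X + M i + minn #|P| m) ->
  exists2 R : {set V}, #|R| = m & forall i P, subpartition P ->
     c i * #|P| <= \sum_(X in P) (s X + meets X R) + M i.
Proof.
move=> sub mV bound.
(* Every constraint is granted an allowance for the [m - r] elements still to come. *)
suff aux r : r <= m -> exists2 R : {set V}, #|R| = r &
    forall i P, subpartition P ->
      c i * #|P| <= \sum_(X in P) (s X + meets X R) + M i + (m - r).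
  have [R Rm HR] := aux m (leqnn m).
  by exists R => // i P sP; have := HR i P sP; rewrite subnn addn0.
elim: r => [_|r IHr ltr].
  exists set0; rewrite ?cards0 // => i P /(bound i)/leq_trans; apply.
  by rewrite big_split /=; lia.
have [R Rr HR] := IHr (ltnW ltr).
pose t X := s X + meets X R.
have sub_t := intersecting_submodular_meets R sub.
have r0 : 0 < m - r by lia.
have bound_unhit i P : subpartition P ->
    c i * #|P| <= \sum_(X in P) t X + M i + #|unhit R P|.
  move=> /(bound i); rewrite /t big_split /= -(unhit_card P R).
  move: (\sum_(X in P) meets X R) (\sum_(X in P) s X) #|unhit R P| (c i * _) => a b u d; lia.
have [v vR vfree] : exists2 v, v \notin R &
    forall i P, tight t c M (m - r) i P -> v \in free R P.
  have [/existsP[i /existsP[P tP]]|none] :=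
      boolP [exists i, exists P, tight t c M (m - r) i P].
    have [|v vfree] := common_free sub_t r0 HR bound_unhit; first by exists i, P.
    exists v => //; have /in_free[X [_ nX vX]] := vfree _ _ tP.
    by apply: contra nX => vR; apply/meetsP; exists v.
  (* With no tight constraint any node outside [R] will do; there is one because [r < m <= #|V|]. *)
  have : R != setT by apply: contraTneq ltr => RT; rewrite -leqNgt -Rr RT cardsT.
  rewrite -subTset => /subsetPn[v _ vR]; exists v => // i P tP.
  by case/negP: none; apply/existsP; exists i; apply/existsP; exists P.
exists (v |: R); first by rewrite cardsU1 vR Rr.
(* The allowance drops by one: a tight constraint gains one from [v], a slack one has a unit to
   spare. *)
move=> i P sP; have := HR i P sP; rewrite leq_eqVlt => /predU1P[e|].
  have /vfree/sum_meetsU1 : tight t c M (m - r) i P by rewrite /tight sP e eqxx.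
  by move: e; rewrite !big_split /=; lia.
have : \sum_(X in P) (s X + meets X R) <= \sum_(X in P) (s X + meets X (v |: R)).
  by apply: leq_sum => X _; rewrite leq_add2l meetsU1; case: (v \in X); case: meets.
by lia.
Qed.

(* The concave function q |-> \sum_m minn q m is the minimum over h of linear
   functions, attained at h = q. *)
Lemma sum_minn_le (ms : seq nat) q h :
  \sum_(m <- ms) minn q m <= count (ltn h) ms * q + \sum_(m <- ms | m <= h) m.
Proof.
elim: ms => [|m ms IH]; rewrite ?big_nil // !big_cons /=; case: leqP => //= _; lia.
Qed.

Lemma sum_minn_eq (ms : seq nat) q :
  \sum_(m <- ms) minn q m = count (ltn q) ms * q + \sum_(m <- ms | m <= q) m.
Proof.
elim: ms => [|m ms IH]; rewrite ?big_nil // !big_cons /=; case: leqP => //= _; lia.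
Qed.

Lemma exists_hitting_sets K (ms : seq nat) (s : {set V} -> nat) :
  intersecting_submodular s -> all (fun m => m <= #|V|) ms ->
  (forall P, subpartition P ->
     K * #|P| <= \sum_(X in P) s X + \sum_(m <- ms) minn #|P| m) ->
  exists2 Rs : seq {set V}, map (fun R : {set V} => #|R|) Rs = ms &
    forall X, X != set0 -> K <= s X + count (meets X) Rs.
Proof.
elim: ms s => [|m ms IH] s sub /=.
  move=> _ bound; exists [::] => // X /subpartition1/bound.
  by rewrite cards1 big_nil big_set1 muln1 /= !addn0.
case/andP=> mV msV bound.
(* One constraint per linear function above the concave one, with [h] covering all possible values
   of [#|P|]. The slope of that function is moved to the left and subtracted from [K]. *)
pose I := 'I_#|{set V}|.+1.
pose c (h : I) := K - count (ltn h) ms.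
pose M (h : I) := \sum_(m <- ms | m <= h) m.
have [|R Rm HR] := @exists_hitting_set s I c M m sub mV.
  move=> h P /bound; rewrite big_cons mulnBl leq_subLR => /leq_trans; apply.
  move: (sum_minn_le ms #|P| h); rewrite -/(M h).
  move: (\sum_(X in P) s X) (\sum_(j <- ms) minn #|P| j) (M h) (count _ _ * _).
  by move: (minn #|P| m); lia.
have [||Rs Rsm HRs] := IH (fun X => s X + meets X R) _ msV.
- exact: intersecting_submodular_meets.
(* At [h = #|P|] the linear function agrees with the concave one. *)
- move=> P sP; have ltP : #|P| < #|{set V}|.+1 by rewrite ltnS max_card.
  have := HR (Ordinal ltP) P sP; rewrite mulnBl leq_subLR sum_minn_eq /M /=; lia.
by exists (R :: Rs) => [|X /HRs]; rewrite /= ?Rm ?Rsm // addnA.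
Qed.

End Uncrossing.

(** * Edmonds' theorem *)

(* [head] alone would denote [seq.head]. *)
Local Notation head := Defs.head.

Section Digraph.
Variables (V A : finType) (D : digraph V A).
Implicit Types (X Y R : {set V}) (F B : {set A}) (a e : A) (u v : V).

(** * Arcs entering a set *)

Definition entering F X := [set a in F | (tail D a \notin X) && (head D a \in X)].

Lemma rho_entering X : rho D X = #|entering setT X|.
Proof. by apply: eq_card => a; rewrite !inE. Qed.

Lemma entering_sum F X :
  #|entering F X| = \sum_(a in F) ((tail D a \notin X) && (head D a \in X)).
Proof.
rewrite -sum1_card (eq_bigl _ _ (in_set _)) big_mkcondr.
by apply: eq_bigr => a _; case: (_ && _).
Qed.

Lemma entering_submodular F X Y :
  #|entering F (X :&: Y)| + #|entering F (X :|: Y)| <=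
  #|entering F X| + #|entering F Y|.
Proof.
rewrite !entering_sum -!big_split /=; apply: leq_sum => a _; rewrite !inE.
by do 4!case: (_ \in _).
Qed.

Lemma disjoint_setU1 (T : finType) (x : T) (S S' : {set T}) :
  [disjoint x |: S & S'] = (x \notin S') && [disjoint S & S'].
Proof. by rewrite -disjointU1; apply: eq_disjoint => y; rewrite !inE. Qed.

(** * Forests and branchings *)

Section ForestExtension.
Variables (B : {set A}) (e : A) (v : V).
Hypotheses (forestB : is_forest D B) (headE : head D e = v) (tailE : tail D e != v).
Hypothesis Bv : forall a, a \in B -> (tail D a != v) && (head D a != v).

Lemma joins_avoid a x y : a \in B -> joins D a x y -> (x != v) && (y != v).
Proof.
move=> /Bv/andP[ta ha] /orP[] /andP[/eqP<- /eqP<-]; first by rewrite ta.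
by rewrite ha.
Qed.

(** A cycle through [e] is rotated to start with [e]. Its last arc is in [B], so it does not start
    at [v]; hence its second node is [v], which no arc of [B] can leave or enter. *)
Lemma is_forest_setU1 : is_forest D (e |: B).
Proof.
move=> s; apply/negP => /and5P[s0 uV uA sB cyc].
have [eS|eS] := boolP (e \in map snd s); last first.
  case/negP: (forestB s); rewrite /undirected_cycle s0 uV uA cyc andbT /=.
  apply/allP => p ps; have /setU1P[pe|//] := allP sB p ps.
  by case/negP: eS; rewrite -pe map_f.
have /mapP[p ps pe] := eS; have [i s' es] := rot_to ps.
move: cyc uA; rewrite -(rot_cycle i) -(rot_uniq i) -map_rot es /=.
have {}sB q : q \in s' -> q.2 != e -> q.2 \in B.
  move=> qs; have : q \in rot i s by rewrite es inE qs orbT.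
  by rewrite mem_rot => /(allP sB)/setU1P[->|//]; rewrite eqxx.
rewrite -pe => cyc /andP[eN _].
have {eN} sB' q : q \in s' -> q.2 \in B.
  by move=> qs; apply: sB => //; apply: contraNneq eN => <-; apply: map_f.
(* A cycle of length one would make [e] a loop. *)
case: s' sB' cyc {es sB} => [|q s'] sB' /=.
  by rewrite -pe /joins headE andbT orbb => /andP[/eqP<- /eqP tv]; case/negP: tailE; rewrite tv.
rewrite rcons_path => /and3P[pq + last_p].
have pv : p.1 != v.
  by have /andP[] := joins_avoid (sB' _ (mem_last _ _)) last_p.
have qv : q.1 = v.
  move: pq; rewrite -pe /joins headE => /orP[] /andP[/eqP a /eqP b] //.
  by rewrite b eqxx in pv.
move=> path_q; have qB := sB' _ (mem_head _ _).
suff [y /(joins_avoid qB)] : exists y, joins D q.2 q.1 y by rewrite qv eqxx.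
case: s' path_q last_p {sB' qB} => [_ jq|z s' /andP[jq _] _]; first by exists p.1.
by exists z.1.
Qed.

End ForestExtension.

Lemma orbit_eventually_cycle (f : V -> V) x : exists n, fcycle f (orbit f (iter n f x)).
Proof.
have /trajectP[i lti e] := looping_order f x.
(* The iterate of rank [order f x] equals that of rank [i], so the latter has period
   [order f x - i]; the criterion asks for the predecessor of a period. *)
exists i; apply/(orbitPcycle 3 0); exists (order f x - i.+1).
by rewrite -iterD -[RHS]e; congr (iter _ f x); lia.
Qed.

Lemma forest_no_closed_set B X : is_forest D B -> X != set0 ->
  (forall v, v \in X -> exists2 a, a \in B & head D a = v) ->
  exists2 a, a \in B & a \in entering B X.
Proof.
move=> forestB /set0Pn[x xX] inX.
have [a0 _ _] := inX x xX.
(* [a0] only makes [arc] total; on [X] the choice succeeds. *)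
pose arc v := odflt a0 [pick a in B | head D a == v].
have arcP v : v \in X -> arc v \in B /\ head D (arc v) = v.
  move=> /inX[a aB ha]; rewrite /arc; case: pickP => [b /andP[bB /eqP]|/(_ a)] //=.
  by rewrite aB ha eqxx.
have [/existsP[v /andP[vX tv]]|closed] :=
    boolP [exists v, (v \in X) && (tail D (arc v) \notin X)].
  have [aB ha] := arcP v vX.
  by exists (arc v) => //; rewrite inE aB tv ha vX.
pose f v := tail D (arc v).
have fX v : v \in X -> f v \in X.
  by move=> vX; apply: contraNT closed => nX; apply/existsP; exists v; rewrite vX.
have iterX n v : v \in X -> iter n f v \in X by move=> vX; elim: n => //= n /fX.
have [n cyc] := orbit_eventually_cycle f x.
set y := iter n f x in cyc; have yX : y \in X by apply: iterX.
have orbX z : z \in orbit f y -> z \in X.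
  by move=> /trajectP[i _ ->]; apply: iterX.
(* The orbit follows arcs backwards: [arc z] joins [z] to its tail [f z]. Distinct heads make these
   arcs distinct. *)
case/negP: (forestB [seq (z, arc z) | z <- orbit f y]).
rewrite /undirected_cycle -!map_comp map_id_in // orbit_uniq; apply/and5P; split=> //.
- by rewrite -size_eq0 size_map size_orbit -lt0n order_gt0.
- rewrite map_inj_in_uniq ?orbit_uniq // => u v /orbX/arcP[_ hu] /orbX/arcP[_ hv] /= e.
  by rewrite -hu e.
- by apply/allP => _ /mapP[z /orbX/arcP[zB _] ->].
apply: (homo_cycle_in (P := mem X) (e := frel f)) cyc; last by apply/allP => z /orbX.
by move=> z w /arcP[_ hz] _ /eqP fz; rewrite /joins hz eqxx -/(f z) fz eqxx orbT.
Qed.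

Lemma card_roots B : is_branching D B ->
  #|[set v | in_degree D B v == 0]| = #|V| - #|B|.
Proof.
case=> _ inB.
have -> : #|B| = \sum_v in_degree D B v.
  rewrite -sum1_card (partition_big (head D) xpredT) //=; apply: eq_bigr => v _.
  by rewrite /in_degree -sum1_card; apply: eq_bigl => a; rewrite inE.
have -> : #|V| = \sum_(v : V) 1 by rewrite sum1_card.
rewrite -sum1_card; set s := \sum_(v in _) 1.
have -> : \sum_(v : V) 1 = s + \sum_v in_degree D B v.
  rewrite /s [X in _ = X + _]big_mkcond -big_split /=; apply: eq_bigr => v _; rewrite inE.
  by case: (in_degree D B v) (inB v) => [|[]].
by rewrite addnK.
Qed.

(** Each member contains a root or is entered by an arc of [B]; being disjoint, the members share
    the [#|V| - #|B|] roots. *)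
Lemma branching_entering B P : is_branching D B -> subpartition P ->
  #|P| <= \sum_(X in P) #|entering B X| + (#|V| - #|B|).
Proof.
move=> brB sP; rewrite -card_roots //; set S := [set v | _].
have le X : X \in P -> 1 <= #|entering B X| + \sum_(v in X) (v \in S).
  move=> XP; rewrite addn_gt0; have [/existsP[v /andP[vX vS]]|noroot] :=
    boolP [exists v, (v \in X) && (v \in S)].
    by rewrite (bigD1 v vX) vS orbT.
  case/subpartitionP: sP => _ /(_ _ XP) X0.
  have [|a _ aX] := forest_no_closed_set (proj1 brB) X0 _.
    move=> v vX; have : v \notin S.
      by apply: contra noroot => vS; apply/existsP; exists v; rewrite vX.
    rewrite inE -lt0n card_gt0 => /set0Pn[a /setIdP[aB /eqP ha]].
    by exists a.
  by rewrite card_gt0; apply/orP; left; apply/set0Pn; exists a.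
rewrite -sum1_card. apply: leq_trans (leq_sum (index_enum _) le) _.
rewrite big_split leq_add2l /= -big_trivIset /=; last by case/andP: sP.
by rewrite -sum1_card [leqRHS]big_mkcond [leqLHS]big_mkcond leq_sum // => v _;
  case: (v \in S); case: ifP.
Qed.

Lemma sum_entering (T : finType) (B : T -> {set A}) X :
  (forall i j, i != j -> [disjoint B i & B j]) ->
  \sum_i #|entering (B i) X| <= rho D X.
Proof.
move=> dis; rewrite rho_entering entering_sum.
under eq_bigr do rewrite entering_sum.
rewrite -partition_disjoint_bigcup //= [leqLHS]big_mkcond [leqRHS]big_mkcond.
by apply: leq_sum => a _; rewrite in_setT; case: ifP.
Qed.

(** * Packing branchings with prescribed root sets *)

Section Packing.
Variable T : finType.
Implicit Types (Rs : T -> {set V}) (Bs : T -> {set A}) (i j : T).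

(** The demand of [X]: each branching whose root set misses [X] needs an arc of its own entering
    [X]. *)
Definition missing Rs X := #|[set j | ~~ meets X (Rs j)]|.

Lemma missing_sum Rs X : missing Rs X = \sum_j ~~ meets X (Rs j).
Proof.
rewrite /missing -sum1_card big_mkcond; apply: eq_bigr => j _; rewrite inE.
by case: meets.
Qed.

(** The last summand on the left records a strict gain at [j]; it will force the intersection of two
    sets with equality in the cut condition to meet [Rs j]. *)
Lemma missing_supermodular Rs X Y j :
  missing Rs X + missing Rs Y
    + [&& meets X (Rs j), meets Y (Rs j) & ~~ meets (X :&: Y) (Rs j)] <=
  missing Rs (X :&: Y) + missing Rs (X :|: Y).
Proof.
rewrite !missing_sum -!big_split /= (bigD1 j) //= [leqRHS](bigD1 j) //= addnAC.
have I i : [/\ meets (X :&: Y) (Rs i) -> meets X (Rs i) &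
               meets (X :&: Y) (Rs i) -> meets Y (Rs i)].
  by split; apply: meetsSI; rewrite ?subsetIl ?subsetIr.
apply: leq_add; last apply: leq_sum => i _; rewrite meetsU.
  have [] := I j; case: (meets X _); case: (meets Y _); case: (meets (_ :&: _) _);
  by move=> // /(_ isT) // _ /(_ isT).
have [] := I i; case: (meets X _); case: (meets Y _); case: (meets (_ :&: _) _);
by move=> // /(_ isT) // _ /(_ isT).
Qed.

Definition grow Rs j v i := if i == j then v |: Rs i else Rs i.

Lemma missing_grow Rs j v X :
  missing (grow Rs j v) X + ((v \in X) && ~~ meets X (Rs j)) = missing Rs X.
Proof.
rewrite !missing_sum (bigD1 j) //= [RHS](bigD1 j) //= addnAC /grow eqxx meetsU1.
congr (_ + _); first by case: (v \in X); case: meets.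
by apply: eq_bigr => i /negPf->.
Qed.

(** Deleting [e] can only hurt a set [Y] that [e] enters, that meets [Rs j] and whose demand equals
    its number of entering arcs. Uncrossing [Y] with the minimal critical set gives a smaller
    critical set, without the tail of [e]. *)
Lemma exists_growing_arc F Rs j :
  (forall X, X != set0 -> missing Rs X <= #|entering F X|) -> Rs j != setT ->
  exists e, [/\ e \in F, tail D e \in Rs j, head D e \notin Rs j &
    forall X, X != set0 ->
      missing (grow Rs j (head D e)) X <= #|entering (F :\ e) X|].
Proof.
move=> cond RT.
(* The arc leads into the part outside Rs j of a minimal critical set X. *)
pose critical X := [&& X != set0, #|entering F X| == missing Rs X,
  meets X (Rs j) & ~~ (X \subset Rs j)].
(* No arc enters the whole node set, so its demand is zero and [Rs j] is nonempty. *)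
have critT : critical setT.
  have [v _ vR] : exists2 v, v \in setT & v \notin Rs j.
    by apply/subsetPn; rewrite subTset.
  have T0 : [set: V] != set0 by apply/set0Pn; exists v.
  have entT : #|entering F setT| = 0.
    by apply/eqP; rewrite cards_eq0; apply/eqP/setP => a; rewrite !inE andbF.
  have := cond _ T0; rewrite entT leqn0 => /eqP m0.
  apply/and4P; split=> //; [by rewrite entT m0 | | by rewrite subTset].
  have /eqP := m0; rewrite cards_eq0 => /eqP/setP/(_ j).
  by rewrite !inE => /negbFE.
have [X /and4P[X0 /eqP eX mX nX] minX] := arg_minnP (fun X => #|X|) critT.
have Z0 : X :\: Rs j != set0 by rewrite setD_eq0.
(* Removing [Rs j] from [X] raises the demand, so some arc enters the difference but not [X]; its
   tail lies in both [X] and [Rs j]. *)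
have : ~~ (entering F (X :\: Rs j) \subset entering F X).
  apply: contraTN isT => /subset_leq_card; rewrite eX leqNgt => /negP[].
  apply: leq_trans (cond _ Z0); apply: proper_card; apply/properP; split.
    apply/subsetP => i; rewrite !inE; apply: contra.
    by apply: meetsSI; apply: subsetDl.
  exists j; rewrite !inE ?mX //.
  by apply/negP => /meetsP[x /setDP[_ xR]]; apply/negP.
case/subsetPn => e; rewrite !inE => /and3P[eF te /andP[he heX]].
rewrite eF heX andbT /= negbK => teX; rewrite teX andbT negbK in te.
exists e; split=> // Y Y0; have := missing_grow Rs j (head D e) Y.
have entE : #|entering (F :\ e) Y| + (e \in entering F Y) = #|entering F Y|.
  rewrite addnC [RHS](cardsD1 e); congr (_ + _); apply: eq_card => a.
  by rewrite !inE -andbA.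
move=> mg; have le_grow : missing (grow Rs j (head D e)) Y <= missing Rs Y.
  by rewrite -mg leq_addr.
have [eY|eY] := boolP (e \in entering F Y); last first.
  by apply: leq_trans le_grow _; move: entE; rewrite (negPf eY) addn0 => ->; apply: cond.
have {entE} entE : #|entering (F :\ e) Y|.+1 = #|entering F Y| by rewrite -entE eY addn1.
have /setIdP[_ /andP[tY hY]] := eY.
have := cond _ Y0; rewrite leq_eqVlt => /predU1P[eqY|]; last first.
  by rewrite -entE ltnS; apply: leq_trans.
(* If [Y] misses [Rs j], adding the head of [e] lowers its demand by one, which pays for [e]. *)
have [mY|nmY] := boolP (meets Y (Rs j)); last first.
  by rewrite -ltnS entE -eqY -mg hY nmY addn1.
have hXY : head D e \in X :&: Y by rewrite inE heX.
have XY0 : X :&: Y != set0 by apply/set0Pn; exists (head D e).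
have XuY0 : X :|: Y != set0 by apply/set0Pn; exists (head D e); rewrite inE heX.
have super := missing_supermodular Rs X Y j; have sub := entering_submodular F X Y.
have lI := cond _ XY0; have lU := cond _ XuY0; rewrite mX mY /= in super.
have mXY : meets (X :&: Y) (Rs j).
  by apply: contraTT isT => nm; rewrite nm in super; clear - super sub lI lU eX eqY; lia.
have : critical (X :&: Y).
  rewrite /critical XY0 mXY; apply/and3P; split=> //.
    by rewrite mXY /= addn0 in super; clear - super sub lI lU eX eqY; apply/eqP; lia.
  by apply/subsetPn; exists (head D e).
move=> /minX; rewrite leqNgt => /negP[]; apply: proper_card; apply/properP.
split; first exact: subsetIl.
by exists (tail D e); rewrite // inE teX.
Qed.

Lemma branching_setU1 B0 R0 e : is_branching D B0 ->
  (forall a, a \in B0 -> (tail D a \in R0) && (head D a \in R0)) ->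
  tail D e \in R0 -> head D e \notin R0 -> is_branching D (e |: B0).
Proof.
move=> [forestB inB] BR te he; split.
  apply: (is_forest_setU1 forestB (erefl (head D e))).
    by apply: contraNneq he => <-.
  by move=> a /BR/andP[ta ha]; apply/andP; split; apply: contraNneq he => <-.
move=> v; rewrite /in_degree; have [<-|nv] := eqVneq (head D e) v.
  rewrite -[leqRHS](cards1 e); apply: subset_leq_card; apply/subsetP => a.
  rewrite !inE => /andP[/predU1P[->|]]; rewrite ?eqxx //.
  by move=> /BR/andP[_ ha] /eqP eh; rewrite -eh ha in he.
apply: leq_trans (inB v); apply: subset_leq_card; apply/subsetP => a.
by rewrite !inE => /andP[/predU1P[->|->]] //; rewrite (negPf nv).
Qed.

(** Generalised for induction on the number of nodes left to reach: [Rs j] holds the nodes already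
    spanned by the partial branching [Bs j], and [F] the arcs still available. Each new arc reaches
    one new node. *)
Lemma edmonds_extend F Rs Bs :
  (forall X, X != set0 -> missing Rs X <= #|entering F X|) ->
  (forall j, is_branching D (Bs j)) ->
  (forall j a, a \in Bs j -> (tail D a \in Rs j) && (head D a \in Rs j)) ->
  (forall i j, i != j -> [disjoint Bs i & Bs j]) ->
  (forall j, [disjoint Bs j & F]) ->
  exists Bs', [/\ forall j, is_branching D (Bs' j),
    forall i j, i != j -> [disjoint Bs' i & Bs' j]
    & forall j, #|Bs' j| = #|Bs j| + #|~: Rs j|].
Proof.
have [n] := ubnP (\sum_j #|~: Rs j|); elim: n F Rs Bs => // n IHn F Rs Bs.
rewrite ltnS => le_n cond brB BR disB disF.
have [/existsP[j RT]|full] := boolP [exists j, Rs j != setT]; last first.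
  exists Bs; split=> // j; suff -> : Rs j = setT by rewrite setCT cards0 addn0.
  by apply: contraNeq full => RT; apply/existsP; exists j.
have [e [eF te he cond']] := exists_growing_arc cond RT.
pose Bs' i := if i == j then e |: Bs i else Bs i.
have eB i : e \notin Bs i.
  by apply/negP => eBi; have /pred0P/(_ e) := disF i; rewrite /= eBi eF.
have cR : #|~: Rs j| = #|~: (head D e |: Rs j)|.+1.
  rewrite (cardsD1 (head D e)) inE he add1n; congr _.+1.
  by apply: eq_card => x; rewrite !inE negb_or.
have [||||||Bs'' [br'' dis'' card'']] := IHn (F :\ e) (grow Rs j (head D e)) Bs'.
- apply: leq_trans le_n; rewrite (bigD1 j) //= [leqRHS](bigD1 j) //=.
  rewrite /grow eqxx cR ltnS leq_add2l leq_sum // => i /negPf->.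
  by rewrite leqnn.
- exact: cond'.
- move=> i; rewrite /Bs'; case: eqP => // ->.
  exact: branching_setU1 (brB j) (BR j) te he.
- move=> i a; rewrite /Bs' /grow; case: eqP => [->|_ /BR//].
  case/setU1P=> [->|/BR/andP[ta ha]]; rewrite !inE ?eqxx ?te ?ta ?ha ?orbT //.
- move=> i l il; rewrite /Bs'; case: eqP => [ij|_]; case: eqP => [lj|_].
  + by rewrite ij lj eqxx in il.
  + by rewrite disjoint_setU1 eB disB.
  + by rewrite disjoint_sym disjoint_setU1 eB disB // eq_sym.
  + exact: disB.
- move=> i; have disD := disjointWr (subD1set F e) (disF _).
  by rewrite /Bs'; case: eqP => _ //; rewrite disjoint_setU1 setD11 disD.
exists Bs''; split=> // i; rewrite card'' /Bs' /grow.
by case: eqP => // ->; rewrite cardsU1 eB cR add1n addnS addSn.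
Qed.

End Packing.
End Digraph.

(** * The two directions of the characterization *)

Lemma disjoint_branchings_necessary (V A : finType) (D : digraph V A) (T : finType)
    (B : T -> {set A}) (P : {set {set V}}) :
  (forall j, is_branching D (B j)) -> (forall i j, i != j -> [disjoint B i & B j]) ->
  subpartition P ->
  \sum_j (#|P| - (#|V| - #|B j|)) <= \sum_(X in P) rho D X.
Proof.
move=> brB disB sP.
apply: (@leq_trans (\sum_j \sum_(X in P) #|entering D (B j) X|)).
  by apply: leq_sum => j _; rewrite leq_subLR addnC branching_entering.
by rewrite exchange_big leq_sum // => X _; apply: sum_entering.
Qed.

Lemma exists_root_sets (V A : finType) (D : digraph V A) k (mu : 'I_k -> nat) :
  (forall P : {set {set V}}, subpartition P ->
     \sum_(j < k) (#|P| - (#|V| - mu j)) <= \sum_(X in P) rho D X) ->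
  exists2 R : 'I_k -> {set V}, forall j, #|R j| = #|V| - mu j &
    forall X, X != set0 -> missing R X <= rho D X.
Proof.
move=> bound; pose ms := [seq #|V| - mu j | j <- enum 'I_k].
have [||P sP|Rs Rsm HRs] := @exists_hitting_sets V k ms (rho D).
- by move=> X Y _; rewrite !rho_entering entering_submodular.
- by apply/allP => _ /mapP[j _ ->]; apply: leq_subr.
(* Termwise, [q] is at most the sum of [q - r] and [minn q r], for [q = #|P|] and
   [r = #|V| - mu j]. *)
- have kq : k * #|P| = \sum_(j < k) #|P| by rewrite sum_nat_const card_ord.
  rewrite big_map big_enum /= kq.
  apply: leq_trans (leq_add (bound P sP) (leqnn _)).
  rewrite -big_split leq_sum // => j _ /=; lia.
have szR : size Rs = k by rewrite -(size_map (fun R : {set V} => #|R|)) Rsm size_map size_enum_ord.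
have eR : Rs = [seq nth set0 Rs (val j) | j <- enum 'I_k].
  by rewrite map_comp val_enum_ord -[in iota _ _]szR -[LHS](mkseq_nth set0).
exists (fun j => nth set0 Rs j) => [j|X X0].
  have j_lt : j < size (enum 'I_k) by rewrite size_enum_ord.
  rewrite -(nth_map set0 0 (fun R : {set V} => #|R|)) ?szR // Rsm.
  by rewrite (nth_map j) // nth_ord_enum.
have := HRs X X0; rewrite {1}eR count_map -sum1_count big_enum_cond sum1dep_card.
set hits := [set j | _]; rewrite addnC -leq_subLR; apply: leq_trans.
rewrite /missing cardsCs card_ord leq_sub2l // subset_leq_card //.
by apply/subsetP => j; rewrite !inE negbK.
Qed.

(* Since mu j <= #|V| - 1, the inner subtraction is exact, and the truncated
   outer one is the positive part [q - (n - mu j)]^+. *)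
Theorem theorem23 (V A : finType) (D : digraph V A) (k : nat) (mu : 'I_k -> nat)
    (mu_pos : forall j, 0 < mu j) (mu_le : forall j, mu j <= #|V| - 1) :
  (exists B : 'I_k -> {set A},
     [/\ forall j, is_branching D (B j),
         forall i j, i != j -> [disjoint B i & B j]
       & forall j, #|B j| = mu j])
  <->
  (forall P : {set {set V}}, subpartition P ->
     \sum_(j < k) (#|P| - (#|V| - mu j)) <= \sum_(X in P) rho D X).
Proof.
split=> [[B [brB disB cardB]] P sP|/exists_root_sets[R cardR roots]].
  rewrite (eq_bigr (fun j => #|P| - (#|V| - #|B j|))) => [|j _]; last by rewrite cardB.
  exact: disjoint_branchings_necessary.
(* Start from empty branchings with all arcs available; each gains one arc per node outside its root
   set. *)
have [||||| B [brB disB cardB]] := @edmonds_extend V A D _ setT R (fun=> set0).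
- by move=> X /roots; rewrite rho_entering.
- move=> j; split=> [s|v].
    by apply/negP => /and5P[+ _ _ +]; case: s => //= p s _; rewrite inE.
  by rewrite [X in X <= _](_ : _ = 0) //; apply: eq_card0 => a; rewrite !inE.
- by move=> j a; rewrite inE.
- by move=> i j _; rewrite -setI_eq0 set0I.
- by move=> j; rewrite -setI_eq0 set0I.
exists B; split=> // j; rewrite cardB cards0 cardsCs setCK cardR.
by have := mu_le j; lia.
Qed.
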